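(* Let $n,r,s$ be positive integers. Suppose $(n,r)=1$, $(r,s)=1$, $r\neq s$, and $r\equiv s\bmod n$. Then $H(r,n,s)$ is the metacyclic group \[B\left((r^n-s^n)/n,\ n,\ (s\hat{r})^{\bar{A}},\ 1\right)\] of order $|r^n-s^n|$, where $r\bar{A}\equiv 1\bmod n$ and $r\hat{r}\equiv 1\bmod (r^n-s^n)$.
   Context: $(a,b)$ denotes the greatest common divisor. For a word $w$ in $x_0,\dots,x_{n-1}$, $G_n(w)=\langle x_0,\dots,x_{n-1}\mid w,\theta(w),\dots,\theta^{n-1}(w)\rangle$ where $\theta(x_i)=x_{i+1}$, subscripts modulo $n$. For $r,s>0$, $P(r,n,l,s,f)=G_n\big((x_0x_f\cdots x_{(r-1)f})(x_{(l-1)}x_{(l-1)+f}\cdots x_{(l-1)+(s-1)f})^{-1}\big)$, and $H(r,n,s)=P(r,n,r+1,s,1)$, i.e. $H(r,n,s)=G_n\big((x_0x_1\cdots x_{r-1})(x_rx_{r+1}\cdots x_{r+s-1})^{-1}\big)$. For integers $M,N,R,\lambda$ with $R^N\equiv 1\bmod M$, $B(M,N,R,\lambda)=\langle a,b\mid a^M=1,\ bab^{-1}=a^R,\ b^N=a^{\lambda M/(M,R-1)}\rangle$. The parameter $R$ matters only modulo $M$; powers of the unit $s\hat r$ with possibly negative exponents are read modulo $r^n-s^n$. A group is metacyclic if it has a cyclic normal subgroup with cyclic quotient. *)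

(* Defs.v *)
From HB Require Import structures.
From mathcomp Require Import all_boot all_order all_algebra.
From mathcomp Require Import all_fingroup all_solvable.
From mathcomp Require Import generic_quotient boolp.

Set Implicit Arguments.
Unset Strict Implicit.
Unset Printing Implicit Defensive.

Import GRing.Theory Num.Theory.

Local Open Scope quotient_scope.

(* A letter (x, false) stands for the generator x, and (x, true) for x^-1. *)
Notation word X := (seq (X * bool)).

Definition letter_inv (X : Type) (l : X * bool) : X * bool := (l.1, ~~ l.2).

Definition word_inv (X : Type) (w : word X) : word X :=
  rev [seq letter_inv l | l <- w].

Definition word_expz (X : Type) (w : word X) (k : int) : word X :=
  match k with
  | Posz m => flatten (nseq m w)
  | Negz m => flatten (nseq m.+1 (word_inv w))
  end.

(* Two words represent the same element of < X | rels >. *)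
Inductive pres_rel (X : Type) (rels : word X -> Prop) :
    word X -> word X -> Prop :=
  | pres_refl u : pres_rel rels u u
  | pres_sym u v : pres_rel rels u v -> pres_rel rels v u
  | pres_trans u v w :
      pres_rel rels u v -> pres_rel rels v w -> pres_rel rels u w
  | pres_cancel u l v :
      pres_rel rels (u ++ [:: l; letter_inv l] ++ v) (u ++ v)
  | pres_relator u w v : rels w -> pres_rel rels (u ++ w ++ v) (u ++ v).

Section Presentation.
Variables (X : choiceType) (rels : word X -> Prop).

Definition pres_relb (u v : word X) : bool := `[< pres_rel rels u v >].

Lemma pres_relb_refl : reflexive pres_relb.
Proof. by move=> u; apply/asboolP; apply: pres_refl. Qed.

Lemma pres_relb_sym : symmetric pres_relb.
Proof. by move=> u v; apply/asboolP/asboolP; apply: pres_sym. Qed.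

Lemma pres_relb_trans : transitive pres_relb.
Proof.
by move=> v u w /asboolP uv /asboolP vw; apply/asboolP; apply: pres_trans vw.
Qed.

Canonical pres_equiv :=
  EquivRel pres_relb pres_relb_refl pres_relb_sym pres_relb_trans.

(* The group < X | rels >. *)
Definition pres_group := {eq_quot pres_equiv}.

HB.instance Definition _ := Choice.on pres_group.
HB.instance Definition _ := EqQuotient.on pres_group.

Lemma pres_groupW (P : pres_group -> Prop) :
  (forall u, P (\pi_pres_group u)) -> forall g, P g.
Proof. by move=> Pu g; rewrite -[g]reprK. Qed.

Lemma pres_piP u v :
  reflect (pres_rel rels u v) (\pi_pres_group u == \pi_pres_group v).
Proof. by rewrite eqmodE; apply: asboolP. Qed.

Lemma pres_rel_repr u : pres_rel rels (repr (\pi_pres_group u)) u.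
Proof. by apply/pres_piP; rewrite reprK. Qed.

Lemma pres_rel_cat u u' v v' :
  pres_rel rels u u' -> pres_rel rels v v' -> pres_rel rels (u ++ v) (u' ++ v').
Proof.
move=> uu' vv'; apply: (@pres_trans _ _ _ (u' ++ v)).
  elim: {u u'} uu' => [u|u w _|u w w' _ uw _|u l w|u w w' rw].
  - exact: pres_refl.
  - exact: pres_sym.
  - exact: pres_trans.
  - by rewrite -!catA; apply: pres_cancel.
  - by rewrite -!catA; apply: pres_relator.
elim: {v v'} vv' => [v|v w _|v w w' _ vw _|v l w|v w w' rw].
- exact: pres_refl.
- exact: pres_sym.
- exact: pres_trans.
- by rewrite !(catA u'); apply: pres_cancel.
- by rewrite !(catA u'); apply: pres_relator.
Qed.

Lemma letter_invK : involutive (@letter_inv X).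
Proof. by case=> x b; rewrite /letter_inv /= negbK. Qed.

Lemma word_invK : involutive (@word_inv X).
Proof.
by move=> w; rewrite /word_inv map_rev revK mapK //; apply: letter_invK.
Qed.

Lemma word_inv_cat (u v : word X) :
  word_inv (u ++ v) = word_inv v ++ word_inv u.
Proof. by rewrite /word_inv map_cat rev_cat. Qed.

Lemma pres_rel_invr u : pres_rel rels (u ++ word_inv u) [::].
Proof.
elim: u => [|l u IHu]; first exact: pres_refl.
rewrite -cat1s word_inv_cat -catA [u ++ _]catA.
apply: (pres_trans (v := [:: l] ++ [::] ++ word_inv [:: l])).
  apply: pres_rel_cat; first exact: pres_refl.
  by apply: pres_rel_cat => //; apply: pres_refl.
exact: (pres_cancel rels [::] l [::]).
Qed.

Lemma pres_rel_invl u : pres_rel rels (word_inv u ++ u) [::].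
Proof. by rewrite -{2}[u]word_invK; apply: pres_rel_invr. Qed.

Lemma pres_rel_inv u v :
  pres_rel rels u v -> pres_rel rels (word_inv u) (word_inv v).
Proof.
move=> uv; apply: (pres_trans (v := word_inv u ++ (v ++ word_inv v))).
  rewrite -{1}[word_inv u]cats0; apply: pres_rel_cat; first exact: pres_refl.
  exact: pres_sym (pres_rel_invr _).
rewrite catA -{2}[word_inv v]cat0s; apply: pres_rel_cat; last exact: pres_refl.
apply: pres_trans (pres_rel_invl u).
by apply: pres_rel_cat; [exact: pres_refl | exact: pres_sym].
Qed.

Definition pres_mul (g h : pres_group) : pres_group :=
  \pi_pres_group (repr g ++ repr h).
Definition pres_one : pres_group := \pi_pres_group [::].
Definition pres_inv (g : pres_group) : pres_group :=
  \pi_pres_group (word_inv (repr g)).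

Lemma pres_pi_mul u v :
  pres_mul (\pi_pres_group u) (\pi_pres_group v) = \pi_pres_group (u ++ v).
Proof. by apply/eqP/pres_piP; apply: pres_rel_cat; apply: pres_rel_repr. Qed.

Lemma pres_pi_inv u : pres_inv (\pi_pres_group u) = \pi_pres_group (word_inv u).
Proof. by apply/eqP/pres_piP; apply: pres_rel_inv; apply: pres_rel_repr. Qed.

Lemma pres_mulA : associative pres_mul.
Proof.
move=> f g h; elim/pres_groupW: f => u; elim/pres_groupW: g => v; elim/pres_groupW: h => w.
by rewrite !pres_pi_mul catA.
Qed.

Lemma pres_mul1g : left_id pres_one pres_mul.
Proof. by move=> g; elim/pres_groupW: g => u; rewrite pres_pi_mul. Qed.

Lemma pres_mulg1 : right_id pres_one pres_mul.
Proof. by move=> g; elim/pres_groupW: g => u; rewrite pres_pi_mul cats0. Qed.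

Lemma pres_mulVg : left_inverse pres_one pres_inv pres_mul.
Proof.
move=> g; elim/pres_groupW: g => u; rewrite pres_pi_inv pres_pi_mul.
by apply/eqP/pres_piP; apply: pres_rel_invl.
Qed.

Lemma pres_mulgV : right_inverse pres_one pres_inv pres_mul.
Proof.
move=> g; elim/pres_groupW: g => u; rewrite pres_pi_inv pres_pi_mul.
by apply/eqP/pres_piP; apply: pres_rel_invr.
Qed.

HB.instance Definition _ := isGroup.Build pres_group
  pres_mulA pres_mul1g pres_mulg1 pres_mulVg pres_mulgV.

End Presentation.

Arguments pres_group {X} rels.

Definition group_isog (G H : groupType) : Prop :=
  exists f : {multiplicative G -> H}, bijective f.

Definition shift n (w : word 'I_n) : word 'I_n := [seq (ordS l.1, l.2) | l <- w].

(* The relators w, theta(w), ..., theta^(n-1)(w), with theta(x_i) = x_{i+1}. *)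
Definition cyclic_rels n (w : word 'I_n) (v : word 'I_n) : Prop :=
  exists2 i, (i < n)%N & v = iter i (@shift n) w.

Definition G_group n (w : word 'I_n) : groupType := pres_group (cyclic_rels w).

Local Open Scope ring_scope.

Lemma subscript_subproof n (n_gt0 : (0 < n)%N) (k : int) :
  (absz (k %% n)%Z < n)%N.
Proof.
have n0 : n%:Z != 0 by case: n n_gt0.
by rewrite -ltz_nat gez0_abs ?modz_ge0 // ltz_pmod.
Qed.

Definition subscript n (n_gt0 : (0 < n)%N) (k : int) : 'I_n :=
  Ordinal (subscript_subproof n_gt0 k).

(* x_k x_{k+f} ... x_{k+(m-1)f}, subscripts mod n. *)
Definition xword n (n_gt0 : (0 < n)%N) (m : nat) (k f : int) : word 'I_n :=
  [seq (subscript n_gt0 (k + j%:Z * f), false) | j <- iota 0 m].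

(* x_0 x_f ... x_{(r-1)f} = x_{l-1} x_{l-1+f} ... x_{l-1+(s-1)f} and shifts. *)
Definition P_group (r n : nat) (l : int) (s : nat) (f : int)
    (n_gt0 : (0 < n)%N) : groupType :=
  G_group (xword n_gt0 r 0 f ++ word_inv (xword n_gt0 s (l - 1) f)).

Definition H_group (r n s : nat) (n_gt0 : (0 < n)%N) : groupType :=
  P_group r (r%:Z + 1) s 1 n_gt0.

Arguments P_group r n l s f n_gt0 : clear implicits.
Arguments H_group r n s n_gt0 : clear implicits.

(* a^M = 1, b a b^-1 = a^R, b^N = a^(lam M / gcd(M, R-1)); the generators
   a and b are encoded as false and true. *)
Definition B_rels (M N R lam : int) (v : word bool) : Prop :=
  let a : word bool := [:: (false, false)] in
  let b : word bool := [:: (true, false)] in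
  [\/ v = word_expz a M,
      v = b ++ a ++ word_inv b ++ word_inv (word_expz a R)
    | v = word_expz b N ++
          word_inv (word_expz a (lam * M %/ gcdz M (R - 1))%Z)].

Definition B_group (M N R lam : int) : groupType :=
  pres_group (B_rels M N R lam).

(* R represents x^e modulo K; for e < 0 this means that R is the inverse
   of x^(-e) modulo K. *)
Definition is_expz_mod (K x e R : int) : Prop :=
  match e with
  | Posz m => (R = x ^+ m %[mod K])%Z
  | Negz m => (R * x ^+ m.+1 = 1 %[mod K])%Z
  end.

(* Main.v *)
Require Import Defs.
From mathcomp Require Import all_boot all_order all_algebra.
From mathcomp Require Import all_fingroup all_solvable.
From HB Require Import structures.
From mathcomp Require Import generic_quotient zify ring.

(** Write q = s / r modulo K = r ^ n - s ^ n, so q ^ n = 1, and R = q ^ A with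
    r A = 1 modulo n, so R ^ r = q. In the extension of H(r, n, s) by the
    shift t, with y = x_0 t, the product x_k ... x_(k+m-1) becomes
    t ^ k y ^ m t ^ (- k - m). The defining relations then say that t ^ r
    conjugates y ^ s to y ^ r, which forces y ^ |K| = 1 and makes conjugation
    by t ^ (-1) the R-th power map on <y>. Hence H(r, n, s) consists of the
    elements y ^ i t ^ (- i) with i modulo N = |K|, multiplied by
    i o j = i + R ^ i * j. This law is well defined because n divides N,
    R = 1 modulo n and R ^ n = 1 modulo N. The set of residues modulo N with
    this law is the finite group [twist] below, and both presentations are
    identified with it.

    For H(r, n, s) no extension is built: the products of consecutive
    generators ([run]) satisfy run k m = run (k + 1) (R * m) and have period N
    in m, so i |-> x_0 ... x_(i-1) is a homomorphism from [twist] onto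
    H(r, n, s); its inverse sends x_k to R ^ (- k) ([H_group_twist]).

    For the metacyclic presentation, b goes to 1 and a to n * c for a suitable
    unit c. The words a ^ i b ^ j give at most N elements and have distinct
    images ([B_group_twist]). The only delicate relation is
    b ^ n = a ^ (M / gcd (M, R - 1)), where M = K / n. In the twisted group
    b ^ n is the residue 1 + R + ... + R ^ (n-1). Exponentiation by A permutes
    the powers of q, so this residue is 1 + q + ... + q ^ (n-1), which equals
    r ^ (1-n) * T with T = (r ^ n - s ^ n) / (r - s). On the other side
    gcd (M, R - 1) = |r - s|, because n divides T and R - 1 generates modulo K
    the same ideal as r - s ([gcd_root]); so M / gcd (M, R - 1) is
    T / n up to sign, and c = sgn (r - s) * r ^ (1-n) makes both sides agree
    ([geom_sum_root]). *)

Set Implicit Arguments.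
Unset Strict Implicit.
Unset Printing Implicit Defensive.

Import GRing.Theory Num.Theory.

Local Open Scope group_scope.

(** * Homomorphisms out of a group given by a presentation *)

Section WordEval.
Variables (X : Type) (G : groupType) (h : X -> G).

Definition letter_eval (l : X * bool) : G := if l.2 then (h l.1)^-1 else h l.1.
Definition word_eval (w : word X) : G := \prod_(l <- w) letter_eval l.

Lemma word_eval_nil : word_eval [::] = 1.
Proof. exact: big_nil. Qed.

Lemma word_eval_cons l w : word_eval (l :: w) = letter_eval l * word_eval w.
Proof. exact: big_cons. Qed.

Lemma word_eval_cat u v : word_eval (u ++ v) = word_eval u * word_eval v.
Proof. exact: big_cat. Qed.

Lemma word_eval_gen x : word_eval [:: (x, false)] = h x.
Proof. by rewrite word_eval_cons word_eval_nil mulg1. Qed.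

Lemma letter_eval_inv l : letter_eval (letter_inv l) = (letter_eval l)^-1.
Proof. by case: l => x [] /=; rewrite /letter_eval /= ?invgK. Qed.

Lemma word_eval_inv w : word_eval (word_inv w) = (word_eval w)^-1.
Proof.
elim: w => [|l w IHw]; first by rewrite /word_inv /= word_eval_nil invg1.
rewrite /word_inv /= rev_cons -cats1 word_eval_cat -/(word_inv w) IHw.
by rewrite !word_eval_cons word_eval_nil mulg1 letter_eval_inv invgM.
Qed.

Lemma word_eval_nseq m w : word_eval (flatten (nseq m w)) = word_eval w ^+ m.
Proof.
elim: m => [|m IHm]; first by rewrite word_eval_nil expg0.
by rewrite expgS /= word_eval_cat IHm.
Qed.

(** Negative exponents, which the relators of the metacyclic presentation may
    carry, are replaced by natural ones using the order of the element. *)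
Lemma word_eval_expz (N m : nat) (k : int) w :
  word_eval w ^+ N = 1 -> (k = m%:Z %[mod N])%Z ->
  word_eval (word_expz w k) = word_eval w ^+ m.
Proof.
move=> wN1.
have wmod i j : i = j %[mod N] -> word_eval w ^+ i = word_eval w ^+ j.
  move=> ij; rewrite (divn_eq i N) (divn_eq j N) ij !expgnDr.
  by rewrite ![(_ * N)%N]mulnC !expgnA wN1 !expg1n.
case: k => k km /=.
  by rewrite word_eval_nseq; apply: wmod; move: km; rewrite !modz_nat => -[].
have /wmod: (m + k.+1 = 0 %[mod N])%N.
  move/eqP: km; rewrite eqz_mod_dvd NegzE -opprD dvdzE abszN absz_nat /= => km.
  by apply/eqP; rewrite eqn_mod_dvd // subn0 addnC.
rewrite expgnDr expg0 -[_ ++ _]/(flatten (nseq k.+1 (word_inv w))).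
rewrite word_eval_nseq word_eval_inv expVgn => mk1.
by apply: (mulIg (word_eval w ^+ k.+1)); rewrite mulVg mk1.
Qed.

End WordEval.

Definition pres_gen (X : choiceType) (rels : word X -> Prop) (x : X) :
  pres_group rels := (\pi_(pres_group rels) [:: (x, false)])%qT.

Section PresentationLift.
Variables (X : choiceType) (rels : word X -> Prop) (G : groupType) (h : X -> G).
Hypothesis h_rels : forall w, rels w -> word_eval h w = 1.

Lemma word_eval_pres_rel u v : pres_rel rels u v -> word_eval h u = word_eval h v.
Proof.
elim=> {u v} // [u v w _ -> _ -> //|u l v|u w v rw]; rewrite !word_eval_cat.
  by rewrite !word_eval_cons word_eval_nil mulg1 letter_eval_inv mulgV mul1g.
by rewrite (h_rels rw) mul1g.
Qed.

Definition pres_lift (g : pres_group rels) : G := word_eval h (repr g).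

Lemma pres_lift_pi u : pres_lift (\pi_(pres_group rels)%qT u) = word_eval h u.
Proof. exact/word_eval_pres_rel/pres_rel_repr. Qed.

Lemma pres_liftM : {morph pres_lift : x y / x * y}.
Proof.
move=> x y; elim/pres_groupW: x => u; elim/pres_groupW: y => v.
by rewrite [_ * _]pres_pi_mul !pres_lift_pi word_eval_cat.
Qed.

Lemma pres_liftX k : {morph pres_lift : x / x ^+ k}.
Proof.
move=> x; elim: k => [|k IHk]; last by rewrite !expgS pres_liftM IHk.
by rewrite !expg0 [1]/(pres_one rels) pres_lift_pi word_eval_nil.
Qed.

Lemma pres_lift_gen x : pres_lift (pres_gen rels x) = h x.
Proof. by rewrite pres_lift_pi word_eval_gen. Qed.

End PresentationLift.

Section PresentationGen.
Variables (X : choiceType) (rels : word X -> Prop).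
Let G : groupType := pres_group rels.

Lemma pres_pi_eval u :
  (\pi_(pres_group rels) u)%qT = word_eval (pres_gen rels : X -> G) u.
Proof.
elim: u => [|[x b] u IHu]; first by rewrite word_eval_nil.
rewrite word_eval_cons -IHu -cat1s -pres_pi_mul; congr (_ * _).
by case: b => //; rewrite -[[:: _]]/(word_inv [:: (x, false)]) -pres_pi_inv.
Qed.

Lemma word_eval_rel w : rels w -> word_eval (pres_gen rels : X -> G) w = 1.
Proof.
move=> rw; rewrite -pres_pi_eval; apply/eqP/pres_piP.
by have := pres_relator [::] [::] rw; rewrite cats0.
Qed.

Lemma pres_group_ind (P : G -> Prop) :
  P 1 -> (forall x g, P g -> P (pres_gen rels x * g)) ->
  (forall x g, P g -> P ((pres_gen rels x : G)^-1 * g)) -> forall g, P g.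
Proof.
move=> P1 PM PV g; elim/pres_groupW: g => u; rewrite pres_pi_eval.
elim: u => [|[x b] u IHu]; first by rewrite word_eval_nil.
by rewrite word_eval_cons; case: b; [apply: PV | apply: PM].
Qed.

End PresentationGen.

Lemma group_isogI (G H : groupType) (f : G -> H) :
  {morph f : x y / x * y} -> bijective f -> group_isog G H.
Proof.
move=> fM bij_f.
pose F : {multiplicative G -> H} := HB.pack f (isMultiplicative.Build G H f fM).
by exists F.
Qed.

Lemma group_isog_sym (G H : groupType) : group_isog G H -> group_isog H G.
Proof.
move=> [f [g fK gK]]; apply: (@group_isogI _ _ g); last by exists f.
by move=> x y; apply: (can_inj fK); rewrite gmulfM !gK.
Qed.

Lemma group_isog_trans (G H K : groupType) :
  group_isog G H -> group_isog H K -> group_isog G K.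
Proof.
move=> [f bij_f] [g bij_g]; apply: (@group_isogI _ _ (g \o f)).
  by move=> x y /=; rewrite !gmulfM.
exact: bij_comp.
Qed.

(** * The finite group of twisted addition modulo N *)

Lemma eqmodnD d a b a' b' :
  a = a' %[mod d] -> b = b' %[mod d] -> (a + b = a' + b' %[mod d])%N.
Proof. by move=> aa' bb'; rewrite -modnDm aa' bb' modnDm. Qed.

Lemma eqmodnM d a b a' b' :
  a = a' %[mod d] -> b = b' %[mod d] -> (a * b = a' * b' %[mod d])%N.
Proof. by move=> aa' bb'; rewrite -modnMm aa' bb' modnMm. Qed.

Lemma eqmodnX d a a' k : a = a' %[mod d] -> (a ^ k = a' ^ k %[mod d])%N.
Proof. by move=> aa'; rewrite -modnXm aa' modnXm. Qed.

Lemma eqmodn_dvd e d a b : e %| d -> a = b %[mod d] -> a = b %[mod e].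
Proof. by move=> ed ab; rewrite -(modn_dvdm _ ed) ab modn_dvdm. Qed.

Lemma eqmodn1X d a k : a = 1 %[mod d] -> (a ^ k = 1 %[mod d])%N.
Proof. by move=> /(eqmodnX k); rewrite exp1n. Qed.

Lemma eqmodn_exp d n a i j :
  (a ^ n = 1 %[mod d] -> i = j %[mod n] -> a ^ i = a ^ j %[mod d])%N.
Proof.
move=> an1 ij; rewrite (divn_eq i n) (divn_eq j n) ij !expnD.
apply: eqmodnM => //; rewrite ![(_ * n)%N]mulnC !expnM.
by rewrite (eqmodn1X _ an1) (eqmodn1X _ an1).
Qed.

Definition twist_ok (N n R : nat) :=
  [/\ (0 < N)%N, n %| N, R = 1 %[mod n] & R ^ n = 1 %[mod N]]%N.

(** The proof argument keeps the group structure attached to this alias of the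
    ordinals, since the twisted law is associative only under it. *)
Definition twist N n R of twist_ok N n R : Type := 'I_N.

Section Twist.
Variables (N n R : nat) (ok : twist_ok N n R).
Let T := twist ok.

HB.instance Definition _ := Finite.on T.

Let N_gt0 : (0 < N)%N. Proof. by case: ok. Qed.
Let dvd_nN : n %| N. Proof. by case: ok. Qed.
Let R1 : R = 1 %[mod n]. Proof. by case: ok. Qed.
Let Rn : (R ^ n = 1 %[mod N])%N. Proof. by case: ok. Qed.

Definition tw (i : nat) : T := Ordinal (ltn_pmod i N_gt0).

Lemma tw_eqP i j : (tw i = tw j) <-> (i = j %[mod N]).
Proof. by split=> [[]|ij] //; apply: val_inj. Qed.

Lemma tw_surj (x : T) : exists2 i, (i < N)%N & x = tw i.
Proof.
by exists (val x); [exact: ltn_ord|apply: val_inj; rewrite /= modn_small].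
Qed.

Definition tw_mul (x y : T) : T := tw (val x + R ^ val x * val y).
Definition tw_inv (x : T) : T := tw (R ^ (n.-1 * val x) * (N - val x)).

Lemma tw_expR i j : (i = j %[mod N] -> R ^ i = R ^ j %[mod N])%N.
Proof. by move=> /(eqmodn_dvd dvd_nN); apply: eqmodn_exp. Qed.

Lemma tw_mulE i j : tw_mul (tw i) (tw j) = tw (i + R ^ i * j).
Proof.
apply/tw_eqP/eqmodnD; rewrite /= ?modn_mod //.
by apply: eqmodnM; rewrite ?modn_mod //; apply: tw_expR; rewrite modn_mod.
Qed.

(** The twist does not affect exponents of R, as R is 1 modulo n; this is what
    makes the twisted law associative. *)
Lemma tw_expR_twist i j k : (R ^ (i + R ^ k * j) = R ^ (i + j) %[mod N])%N.
Proof.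
apply: (eqmodn_exp Rn); apply: eqmodnD => //.
by rewrite -[in RHS](mul1n j); apply: eqmodnM => //; apply: eqmodn1X.
Qed.

Lemma tw_mulA : associative tw_mul.
Proof.
move=> x y z; have [i _ ->] := tw_surj x; have [j _ ->] := tw_surj y.
have [k _ ->] := tw_surj z; rewrite !tw_mulE; apply/tw_eqP.
rewrite mulnDr addnA mulnA -expnD; apply: eqmodnD => //.
by apply: eqmodnM => //; rewrite tw_expR_twist.
Qed.

Lemma tw_mul1g : left_id (tw 0) tw_mul.
Proof. by move=> x; have [i _ ->] := tw_surj x; rewrite tw_mulE mul1n. Qed.

Lemma tw_mulVg : left_inverse (tw 0) tw_inv tw_mul.
Proof.
move=> x; have [i lt_iN ->] := tw_surj x; rewrite /tw_inv tw_mulE /= modn_small //.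
apply/tw_eqP; set k := (R ^ _ * _)%N.
have -> : (k + R ^ k * i = k + R ^ (n.-1 * i) * i %[mod N])%N.
  apply: eqmodnD => //; apply: eqmodnM => //; apply: (eqmodn_exp Rn).
  have -> : (k = N - i %[mod n])%N.
    by rewrite -[RHS](congr1 (modn^~ n) (mul1n _)); apply: eqmodnM => //; apply: eqmodn1X.
  apply/eqP; rewrite -(eqn_modDr i) subnK 1?ltnW // -mulSnr.
  case: (posnP n) => [n0|n_gt0]; last by rewrite prednK // modnMr (eqP dvd_nN).
  by move: dvd_nN N_gt0; rewrite n0 dvd0n => /eqP->.
by rewrite /k -mulnDr subnK 1?ltnW // modnMl mod0n.
Qed.

HB.instance Definition _ :=
  Finite_isGroup.Build T tw_mulA tw_mul1g tw_mulVg.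

End Twist.

Section TwistTheory.
Variables (N n R : nat) (ok : twist_ok N n R).
Local Notation tw := (tw ok).

Lemma twM i j : tw i * tw j = tw (i + R ^ i * j).
Proof. exact: tw_mulE. Qed.

Lemma twM_dvd i j : n %| i -> tw i * tw j = tw (i + j).
Proof.
move=> ni; have [_ _ _ Rn] := ok; rewrite twM; apply/tw_eqP; apply: eqmodnD => //.
rewrite -[in RHS](mul1n j); apply: eqmodnM => //.
by rewrite -(divnK ni) mulnC expnM; apply: eqmodn1X.
Qed.

Lemma twX_dvd i k : n %| i -> tw i ^+ k = tw (k * i).
Proof.
move=> ni; elim: k => [|k IHk]; first exact: expg0.
by rewrite expgS IHk twM_dvd // mulSn.
Qed.

Definition geom_sum (R k : nat) := (\sum_(i < k) R ^ i)%N.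

Lemma tw1X k : tw 1 ^+ k = tw (geom_sum R k).
Proof.
rewrite /geom_sum; elim: k => [|k IHk]; first by rewrite big_ord0 expg0.
rewrite expgS IHk twM big_ord_recl expn1 big_distrr /=; congr (tw (_ + _)).
by apply: eq_bigr => i _; rewrite -expnS.
Qed.

Lemma geom_sum_mod k : geom_sum R k = k %[mod n].
Proof.
have [_ _ R1 _] := ok; rewrite /geom_sum; elim: k => [|k IHk]; first by rewrite big_ord0.
by rewrite big_ord_recr /= -addn1; apply: eqmodnD => //; apply: eqmodn1X.
Qed.

(** The i-th power of 1 agrees with i modulo n, so the two differ by an element
    of the subgroup of multiples of n. *)
Lemma tw_decomp i : exists q, tw i = tw (n * q) * tw 1 ^+ i.
Proof.
have [N_gt0 nN _ _] := ok; pose S := geom_sum R i.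
have nd : n %| i + N.-1 * S.
  have -> : (n %| i + N.-1 * S) = (n %| N * S).
    rewrite -(prednK N_gt0) mulSn /dvdn.
    by congr (_ == _); apply: eqmodnD => //; rewrite geom_sum_mod.
  exact: dvdn_mulr.
(* N.-1 stands for - 1 modulo N. *)
exists ((i + N.-1 * S) %/ n)%N; rewrite mulnC divnK // tw1X twM_dvd //.
apply/tw_eqP; rewrite -addnA -/S.
by rewrite -mulSnr prednK // mulnC addnC modnMDl.
Qed.

Lemma card_twist : #|{: twist ok}| = N.
Proof. exact: card_ord. Qed.

(** The multiples of n form a normal cyclic subgroup, and the residue 1 generates
    the quotient. *)
Lemma twist_metacyclic : metacyclic [set: twist ok].
Proof.
apply/existsP; exists [group of <[tw n]>]; rewrite /= cycle_cyclic /=.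
have dnn : n %| n by [].
have tw1_norm : tw 1 \in 'N(<[tw n]>).
  rewrite -groupV inE -cycleJ cycle_subG conjgE invgK.
  have -> : tw 1 * (tw n * (tw 1)^-1) = tw n ^+ R.
    rewrite mulgA; apply/(canLR (mulgK _)); rewrite twX_dvd // twM.
    by rewrite twM_dvd ?dvdn_mull // expn1 addnC.
  exact: mem_cycle.
have defT : [set: twist ok] = <[tw n]> * <[tw 1]>.
  apply/eqP; rewrite eq_sym -subTset; apply/subsetP => x _.
  have [i _ ->] := tw_surj x; have [q ->] := tw_decomp i.
  by rewrite mulnC -twX_dvd // mem_mulg ?mem_cycle.
have nT : [set: twist ok] \subset 'N(<[tw n]>).
  by rewrite defT mul_subG ?normG ?cycle_subG.
by rewrite /normal subsetT nT defT quotientMidl quotient_cyclic // cycle_cyclic.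
Qed.

End TwistTheory.

(** * Products of consecutive generators *)

Definition run (G : groupType) (X : nat -> G) (k m : nat) : G :=
  \prod_(j < m) X (k + j)%N.

Lemma run0 (G : groupType) (X : nat -> G) k : run X k 0 = 1.
Proof. exact: big_ord0. Qed.

Lemma run1 (G : groupType) (X : nat -> G) k : run X k 1 = X k.
Proof. by rewrite /run big_ord1 addn0. Qed.

Lemma runS (G : groupType) (X : nat -> G) k m :
  run X k m.+1 = run X k m * X (k + m)%N.
Proof. exact: big_ord_recr. Qed.

Lemma runD (G : groupType) (X : nat -> G) k m l :
  run X k (m + l) = run X k m * run X (k + m) l.
Proof.
elim: l => [|l IHl]; first by rewrite addn0 run0 mulg1.
by rewrite addnS !runS IHl addnA mulgA.
Qed.

(** The arithmetic data: rhat is an inverse of r modulo N, so that s * rhat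
    stands for s / r, and A is an inverse of r modulo n. The disjunction says that
    N is the absolute value of r ^ n - s ^ n, without fixing its sign. *)
Definition cyclic_ok (n r s N rhat A : nat) :=
  [/\ [/\ (0 < N)%N, n %| N & r = s %[mod n]],
      (r ^ n = s ^ n + N \/ s ^ n = r ^ n + N)%N,
      r * rhat = 1 %[mod N] & r * A = 1 %[mod n]]%N.

Section Arith.
Variables (n r s N rhat A : nat) (ok : cyclic_ok n r s N rhat A).
Let x := (s * rhat)%N.
Let R := (x ^ A)%N.

Lemma ratio_mod_n : x = 1 %[mod n].
Proof.
have [[_ nN rs] _ rr' _] := ok.
rewrite -(eqmodn_dvd nN rr') /x; exact/eqmodnM.
Qed.

Lemma powers_eq : (r ^ n = s ^ n %[mod N])%N.
Proof. by have [_ [] -> _ _] := ok; rewrite modnDr. Qed.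

Lemma ratio_exp_n : (x ^ n = 1 %[mod N])%N.
Proof.
have [_ _ rr' _] := ok.
rewrite expnMn -(eqmodnM powers_eq (erefl (rhat ^ n %% N)%N)) -expnMn.
exact: eqmodn1X.
Qed.

Lemma twist_root_ok : twist_ok N n R.
Proof.
have [[N0 nN _] _ _ _] := ok; split=> //; first exact/eqmodn1X/ratio_mod_n.
by rewrite -expnM mulnC expnM; apply/eqmodn1X/ratio_exp_n.
Qed.

Lemma twist_root_r : (r * R ^ r = s %[mod N])%N.
Proof.
have [_ _ rr' rA] := ok.
have Rr : (R ^ r = x %[mod N])%N.
  by rewrite -expnM mulnC (eqmodn_exp ratio_exp_n rA) expn1.
rewrite (eqmodnM (erefl (r %% N)%N) Rr) /x mulnCA -[in RHS](muln1 s).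
exact: eqmodnM.
Qed.

End Arith.

Section Runs.
Variables (n r s N rhat A : nat) (ok : cyclic_ok n r s N rhat A).
Variables (G : groupType) (X : nat -> G).
Hypothesis X_mod : forall i j, i = j %[mod n] -> X i = X j.
Hypothesis X_rel : forall i, run X i r = run X (i + r) s.
Local Notation W := (run X).
Let x := (s * rhat)%N.
Let R := (x ^ A)%N.

Lemma run_mod i j m : i = j %[mod n] -> W i m = W j m.
Proof. by move=> ij; apply: eq_bigr => k _; apply/X_mod/eqmodnD. Qed.

(** Cutting a product of r * m generators into m blocks of length r and replacing
    each block leaves m consecutive blocks of length s, because r and s agree
    modulo n. *)
Lemma run_rel_mul k m : W k (r * m) = W (k + r) (s * m).
Proof.
have [[_ _ rs] _ _ _] := ok.
elim: m k => [|m IHm] k; first by rewrite !muln0 !run0.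
rewrite !mulnS !runD IHm X_rel; congr (_ * _).
by apply: run_mod; apply: eqmodnD.
Qed.

Lemma run_rel_exp j k m : W k (r ^ j * m) = W (k + j * r) (s ^ j * m).
Proof.
elim: j k m => [|j IHj] k m; first by rewrite addn0.
by rewrite !expnS -!mulnA run_rel_mul mulnCA IHj mulSn addnA [in RHS]mulnCA.
Qed.

(** Replacing n times leads from r ^ n generators to s ^ n generators starting at
    the same place; the longer of the two products therefore ends in a product
    of N generators that is trivial. *)
Lemma run_N k : W k N = 1.
Proof.
have [[_ nN _] pow_rs _ _] := ok.
have rs_n i : W i (r ^ n) = W i (s ^ n).
  have := run_rel_exp n i 1; rewrite !muln1 => ->; apply: run_mod.
  by rewrite mulnC addnC modnMDl.
have shiftN u i : W i (u + N) = W i u -> W (i + u) N = 1.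
  by rewrite runD -{2}[W i u]mulg1 => /mulgI.
have [u Wu] : exists u, forall i, W i (u + N) = W i u.
  by case: pow_rs rs_n => -> rs_n; [exists (s ^ n)%N | exists (r ^ n)%N].
rewrite -(shiftN _ (k + u * n.-1)%N (Wu _)); apply: run_mod.
have n0 : (0 < n)%N by apply: dvdn_gt0 nN; have [[]] := ok.
by rewrite -addnA -mulnSr prednK // addnC modnMDl.
Qed.

Lemma run_modr k i j : i = j %[mod N] -> W k i = W k j.
Proof.
have runMN q l : W l (q * N) = 1.
  elim: q l => [|q IHq] l; first by rewrite run0.
  by rewrite mulSn runD run_N IHq mulg1.
move=> ij; rewrite (divn_eq i N) (divn_eq j N) ij.
by rewrite ![(_ * N + _)%N]addnC !runD !runMN !mulg1.
Qed.

Lemma run_ratio_exp j k m : W k m = W (k + j * r) (x ^ j * m).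
Proof.
have [_ _ rr' _] := ok.
elim: j k m => [|j IHj] k m; first by rewrite mul1n addn0.
rewrite (IHj k) mulSnr addnA expnS -mulnA.
rewrite /x -[(s * rhat * _)%N]mulnA -run_rel_mul mulnA.
by apply: run_modr; rewrite -[in LHS](mul1n (_ * m)%N); apply: eqmodnM.
Qed.

(** A steps of length r move the starting point by r * A, which is 1 modulo n. *)
Lemma run_shift j k m : W k m = W (k + j) (R ^ j * m).
Proof.
have [_ _ _ rA] := ok; rewrite (run_ratio_exp (A * j)) expnM; apply: run_mod.
apply: eqmodnD => //; rewrite mulnAC [(A * r)%N]mulnC.
by rewrite -[in RHS](mul1n j); apply: eqmodnM.
Qed.

Lemma run_shift0 k m : exists i, W k m = W 0 i.
Proof.
exists (R ^ (n.-1 * k) * m)%N; rewrite (run_shift (n.-1 * k)); apply: run_mod.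
have [[N0 nN _] _ _ _] := ok.
by rewrite -mulSn prednK ?(dvdn_gt0 N0) // mulnC modnMl mod0n.
Qed.

Lemma runM0 i j : W 0 i * W 0 j = W 0 (i + R ^ i * j).
Proof. by rewrite (run_shift i 0 j) runD. Qed.

Lemma run_gen_mul k j : exists i, X k * W 0 j = W 0 i.
Proof. by have [i] := run_shift0 k 1; rewrite run1 => ->; rewrite runM0; eexists. Qed.

Lemma run_gen_inv_mul k j : exists i, (X k)^-1 * W 0 j = W 0 i.
Proof.
have [i] := run_shift0 k.+1 N.-1; have [[N0 _ _] _ _ _] := ok => Wi.
suff -> : (X k)^-1 = W 0 i by rewrite runM0; eexists.
apply: (mulgI (X k)); rewrite mulgV -Wi -(run_N k) -{1}(prednK N0) -add1n.
by rewrite runD run1 addn1.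
Qed.

End Runs.

(** * The cyclically presented group as a twisted group *)

Section CyclicWords.
Variables (n : nat) (n_gt0 : (0 < n)%N).
Local Notation sub k := (subscript n_gt0 (Posz k)).

Lemma subscript_mod i j : i = j %[mod n] -> sub i = sub j.
Proof. by move=> ij; apply: val_inj; rewrite /= !modz_nat ij. Qed.

Lemma subscriptK (i : 'I_n) : sub i = i.
Proof. by apply: val_inj; rewrite /= modz_nat modn_small. Qed.

Lemma shift_xword i m k :
  iter i (@shift n) (xword n_gt0 m (Posz k) 1) = xword n_gt0 m (Posz (i + k)) 1.
Proof.
elim: i => [//|i IHi]; rewrite iterS IHi /shift /xword -map_comp.
apply: eq_map => j /=; congr (_, _); apply: val_inj => /=.
by rewrite mulr1 -!PoszD !modz_nat /= -addn1 modnDml addn1.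
Qed.

Lemma shift_cat_inv i (u v : word 'I_n) :
  iter i (@shift n) (u ++ word_inv v) =
  iter i (@shift n) u ++ word_inv (iter i (@shift n) v).
Proof.
elim: i => [//|i IHi]; rewrite !iterS IHi /shift map_cat /word_inv map_rev.
by rewrite -!map_comp.
Qed.

Variables (G : groupType) (h : 'I_n -> G).
Let X k := h (sub k).

Lemma word_eval_xword m k : word_eval h (xword n_gt0 m (Posz k) 1) = run X k m.
Proof.
rewrite /word_eval /xword big_map /= -[m]subn0 -/(index_iota 0 m) big_mkord.
by rewrite subn0; apply: eq_bigr => j _; rewrite mulr1.
Qed.

Lemma cyclic_gen_mod i j : i = j %[mod n] -> X i = X j.
Proof. by move=> ij; congr h; apply: subscript_mod. Qed.

(** Periodicity of the generators extends the relations from the n relators to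
    products starting at any natural index. *)
Lemma cyclic_rels_eval r s :
  (forall w, cyclic_rels (xword n_gt0 r 0 1 ++
       word_inv (xword n_gt0 s (r%:Z + 1 - 1)%R 1)) w -> word_eval h w = 1) <->
  (forall i, run X i r = run X (i + r) s).
Proof.
rewrite addrK; split=> [rels1 i | runE w [i _ ->]]; last first.
  rewrite shift_cat_inv !shift_xword word_eval_cat word_eval_inv.
  by rewrite !word_eval_xword addn0 runE mulgV.
have rel_mod j m : run X (i %% n + j) m = run X (i + j) m.
  by rewrite /run; apply: eq_bigr => k _; apply: cyclic_gen_mod; rewrite -!addnA modnDml.
rewrite -{1}(addn0 i) -!rel_mod addn0; apply/divg1_eq.
rewrite -!word_eval_xword -word_eval_inv -word_eval_cat.
apply: rels1; exists (i %% n)%N; first exact: ltn_pmod.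
by rewrite shift_cat_inv !shift_xword addn0.
Qed.

End CyclicWords.

Section HGroup.
Variables (n r s N rhat A : nat) (n_gt0 : (0 < n)%N).
Hypothesis ok : cyclic_ok n r s N rhat A.
Let R := ((s * rhat) ^ A)%N.
Let Rinv := (R ^ n.-1)%N.
Let tok : twist_ok N n R := twist_root_ok ok.
Local Notation tw := (tw tok).
Local Notation H := (H_group r n s n_gt0).
Local Notation sub k := (subscript n_gt0 (Posz k)).

Let tw_gen (i : 'I_n) : twist tok := tw (Rinv ^ i).
Let X k := tw_gen (sub k).

Lemma root_inv k : (R ^ k * Rinv ^ k = 1 %[mod N])%N.
Proof.
have [_ _ _ Rn] := tok.
by rewrite -expnMn -expnS prednK //; apply: eqmodn1X.
Qed.

Lemma tw_genE k : X k = tw (Rinv ^ k).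
Proof.
have [_ _ _ Rn] := tok; apply/tw_eqP/(@eqmodn_exp _ n).
  by rewrite /Rinv -expnM mulnC expnM; apply: eqmodn1X.
by rewrite /= modz_nat modn_mod.
Qed.

(** The factor R ^ (- k - j) undoes the twist accumulated by the j factors before
    it, so that every factor contributes the same residue R ^ (- k). *)
Lemma tw_run k m : run X k m = tw (m * Rinv ^ k).
Proof.
have [_ _ R1 Rn] := tok.
elim: m => [|m IHm]; first exact: run0.
rewrite runS IHm tw_genE twM mulSnr; apply/tw_eqP/eqmodnD => //.
rewrite expnD mulnCA -[in RHS](muln1 (Rinv ^ k)%N); apply: eqmodnM => //.
rewrite -(root_inv m); apply: eqmodnM => //; apply: (eqmodn_exp Rn).
by rewrite -[in RHS](muln1 m); apply: eqmodnM => //; apply/eqmodn1X/eqmodn1X.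
Qed.

Lemma tw_rel i : run X i r = run X (i + r) s.
Proof.
rewrite !tw_run; apply/tw_eqP; rewrite addnC expnD mulnA.
apply: eqmodnM => //; rewrite -[in LHS](muln1 r).
rewrite -(eqmodnM (erefl (r %% N)%N) (root_inv r)) mulnA.
by apply: eqmodnM => //; apply: (twist_root_r ok).
Qed.

Lemma H_group_twist : group_isog H (twist tok).
Proof.
pose rels := cyclic_rels (xword n_gt0 r 0 1 ++
  word_inv (xword n_gt0 s (r%:Z + 1 - 1)%R 1)).
have tw_rels w : rels w -> word_eval tw_gen w = 1.
  by move: w; apply/cyclic_rels_eval/tw_rel.
pose Y k : H := pres_gen rels (sub k).
have Y_mod i j : i = j %[mod n] -> Y i = Y j by apply: cyclic_gen_mod.
have Y_rel i : run Y i r = run Y (i + r) s.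
  by move: i; apply/cyclic_rels_eval => w; apply: word_eval_rel.
have H_run (g : H) : exists i, g = run Y 0 i.
  elim/pres_group_ind: g => [|x g [i ->]|x g [i ->]].
  - by exists 0%N; exact/esym/run0.
  - by rewrite -(subscriptK n_gt0 x); apply: (run_gen_mul ok).
  - by rewrite -(subscriptK n_gt0 x); apply: (run_gen_inv_mul ok).
pose f : H -> twist tok := pres_lift tw_gen.
have f_run i : f (run Y 0 i) = tw i.
  rewrite /Y -word_eval_xword -pres_pi_eval /f pres_lift_pi // word_eval_xword.
  by rewrite tw_run muln1.
(* The inverse sends the residue of i to x_0 ... x_(i-1). *)
apply: (@group_isogI _ _ f); first exact: pres_liftM.
exists (fun t : twist tok => run Y 0 (val t)) => [g | t].
  by have [i ->] := H_run g; rewrite f_run; apply: (run_modr ok) => //; apply: modn_mod.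
by rewrite f_run; have [i _ ->] := tw_surj t; apply/tw_eqP/modn_mod.
Qed.

End HGroup.

(** * The metacyclic presentation as a twisted group *)

Section MetacyclicWords.
Variables (G : groupType) (a b : G) (M n R e : nat).
Hypotheses (M_gt0 : (0 < M)%N) (n_gt0 : (0 < n)%N).
Hypotheses (aM : a ^+ M = 1) (baV : b * a * b^-1 = a ^+ R) (bn : b ^+ n = a ^+ e).

Lemma metacyclic_commute i j : b ^+ j * a ^+ i = a ^+ (R ^ j * i) * b ^+ j.
Proof.
have ba k : b * a ^+ k = a ^+ (R * k) * b.
  elim: k => [|k IHk]; first by rewrite muln0 !expg0 mulg1 mul1g.
  rewrite expgS mulnS expgnDr -[RHS]mulgA -IHk !mulgA; congr (_ * _).
  by rewrite -baV mulgVK.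
elim: j i => [|j IHj] i; first by rewrite mul1n !expg0 mulg1 mul1g.
by rewrite !expgS -mulgA IHj mulgA ba mulgA expnS mulnA.
Qed.

(** Exponents of b are first reduced modulo n, which creates powers of a, and
    exponents of a afterwards. *)
Lemma metacyclic_normal_form i j :
  exists p : 'I_M * 'I_n, a ^+ i * b ^+ j = a ^+ p.1 * b ^+ p.2.
Proof.
exists (Ordinal (ltn_pmod (i + j %/ n * e) M_gt0), Ordinal (ltn_pmod j n_gt0)).
rewrite {1}(divn_eq j n) expgnDr mulnC expgnA bn -expgnA mulgA -expgnDr mulnC.
by rewrite {1}(divn_eq (i + _) M) expgnDr mulnC expgnA aM expg1n mul1g.
Qed.

Lemma metacyclic_mul i j i' j' :
  exists k l, a ^+ i * b ^+ j * (a ^+ i' * b ^+ j') = a ^+ k * b ^+ l.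
Proof.
exists (i + R ^ j * i')%N, (j + j')%N.
by rewrite !expgnDr !mulgA -(mulgA _ (b ^+ j)) metacyclic_commute !mulgA.
Qed.

Lemma metacyclic_inva : a^-1 = a ^+ M.-1 * b ^+ 0.
Proof.
by apply: (mulgI a); rewrite expg0 mulg1 mulgV -expgS prednK.
Qed.

Lemma metacyclic_invb : exists i, b^-1 = a ^+ i * b ^+ n.-1.
Proof.
exists (M.-1 * e)%N; apply: (mulIg b); rewrite mulVg -mulgA -expgSr prednK //.
by rewrite bn -expgnDr -mulSnr prednK // expgnA aM expg1n.
Qed.

End MetacyclicWords.

Section BGroup.
Variables (N n R : nat) (ok : twist_ok N n R) (M c e : nat).
Hypotheses (defN : (M * n)%N = N) (co_cN : coprime c N).
Hypothesis ce : (n * c * e = geom_sum R n %[mod N])%N.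
Variables (Mz Rz : int).
Hypotheses (defM : `|Mz|%N = M) (defR : (Rz = R %[mod M])%Z).
Hypothesis defe : ((1 * Mz %/ gcdz Mz (Rz - 1))%Z = e%:Z %[mod M])%Z.
Local Notation B := (B_group Mz n%:Z Rz 1).
Local Notation tw := (tw ok).

(** Evaluation turns the relators, whose exponents are integers, into relations
    with natural exponents. *)
Lemma B_rels_eval (G : groupType) (h : bool -> G) :
  (forall w, B_rels Mz n%:Z Rz 1 w -> word_eval h w = 1) <->
  [/\ h false ^+ M = 1, h true * h false * (h true)^-1 = h false ^+ R
    & h true ^+ n = h false ^+ e].
Proof.
have aMz : word_eval h (word_expz [:: (false, false)] Mz) = 1 <-> h false ^+ M = 1.
  case: Mz defM => m <-; first by rewrite /word_expz word_eval_nseq word_eval_gen.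
  rewrite -[word_expz _ _]/(flatten (nseq m.+1 (word_inv [:: (false, false)]))).
  rewrite word_eval_nseq word_eval_inv word_eval_gen expVgn.
  by split=> [/(congr1 inv)|->]; rewrite ?invgK invg1.
have bn : word_eval h (word_expz [:: (true, false)] n) = h true ^+ n.
  by rewrite /= word_eval_nseq word_eval_gen.
have aexp (k : int) (m : nat) : (k = m%:Z %[mod M])%Z -> h false ^+ M = 1 ->
    word_eval h (word_expz [:: (false, false)] k) = h false ^+ m.
  by move=> km aM; rewrite (@word_eval_expz _ _ _ M m) // word_eval_gen.
split=> [relsE | [aM baV bne] w []->].
- have aM : h false ^+ M = 1 by apply/aMz/relsE; constructor 1.
  split=> //.
    have := relsE _ (Or32 _ _ (erefl _)).
    rewrite !word_eval_cat !word_eval_inv !word_eval_gen (aexp _ _ defR aM) !mulgA.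
    exact: divg1_eq.
  have := relsE _ (Or33 _ _ (erefl _)).
  rewrite word_eval_cat word_eval_inv bn (aexp _ _ defe aM); exact: divg1_eq.
- exact/aMz.
- rewrite !word_eval_cat !word_eval_inv !word_eval_gen (aexp _ _ defR aM) !mulgA.
  by rewrite baV mulgV.
- by rewrite word_eval_cat word_eval_inv bn (aexp _ _ defe aM) bne mulgV.
Qed.

Let alpha := tw (n * c).
Let beta := tw 1.

Lemma tw_metacyclic_rels :
  [/\ alpha ^+ M = 1, beta * alpha * beta^-1 = alpha ^+ R
    & beta ^+ n = alpha ^+ e].
Proof.
have dnc : n %| n * c by apply: dvdn_mulr.
have alphaX k : alpha ^+ k = tw (k * (n * c)) by apply: twX_dvd.
split; rewrite ?alphaX /alpha /beta.
- by apply/tw_eqP; rewrite mulnA defN modnMr mod0n.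
- apply/(canLR (mulgK _)); rewrite twM twM_dvd; last exact: dvdn_mull.
  by rewrite expn1 addnC.
- by rewrite tw1X; apply/tw_eqP; rewrite mulnC ce.
Qed.

(** Modulo n only the exponent of b is visible; once it is known, the exponent
    of a is determined modulo M since c is a unit. *)
Lemma tw_normal_form_inj (p q : 'I_M * 'I_n) :
  alpha ^+ p.1 * beta ^+ p.2 = alpha ^+ q.1 * beta ^+ q.2 -> p = q.
Proof.
have [N_gt0 nN R1 _] := ok; have n_gt0 : (0 < n)%N by apply: dvdn_gt0 nN.
have dnc i : n %| i * (n * c) by rewrite dvdn_mull ?dvdn_mulr.
case: p q => [i j] [i' j'] /=.
have alphaX k : alpha ^+ k = tw (k * (n * c)) by apply/twX_dvd/dvdn_mulr.
rewrite !alphaX /beta !tw1X !twM_dvd // => /tw_eqP eqN.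
have eqj : j = j'.
  apply/val_inj; move: (eqmodn_dvd nN eqN).
  rewrite ![(_ * (n * c))%N]mulnCA ![(n * _)%N]mulnC !modnMDl.
  by rewrite !(geom_sum_mod ok) !modn_small.
congr (_, _) => //; apply/val_inj; move/eqP: eqN; rewrite eqj eqn_modDr.
rewrite -defN ![(_ * (n * c))%N]mulnCA -![(n * (_ * c))%N]mulnC.
rewrite -!muln_modl // eqn_pmul2r //.
have co_cM : coprime M c.
  by rewrite coprime_sym; apply: coprime_dvdr co_cN; rewrite -defN dvdn_mulr.
wlog le_ii' : i i' / (i <= i')%N => [IH /eqP ii'|].
  by case: (leqP i i') => [|/ltnW] le_ii'; [|symmetry]; apply: IH => //; rewrite ii'.
rewrite eq_sym eqn_mod_dvd ?leq_mul2r ?le_ii' ?orbT // -mulnBl Gauss_dvdl //.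
rewrite -eqn_mod_dvd // => /eqP; rewrite !modn_small //.
Qed.

Lemma B_group_twist : group_isog B (twist ok).
Proof.
have [N_gt0 nN R1 _] := ok; have n_gt0 : (0 < n)%N by apply: dvdn_gt0 nN.
have M_gt0 : (0 < M)%N by move: N_gt0; rewrite -defN muln_gt0 => /andP[].
pose h (x : bool) := if x then beta else alpha.
have h_rels : forall w, B_rels Mz n%:Z Rz 1 w -> word_eval h w = 1.
  exact/B_rels_eval/tw_metacyclic_rels.
pose a : B := pres_gen _ false; pose b : B := pres_gen _ true.
have [aM baV bn] : [/\ a ^+ M = 1, b * a * b^-1 = a ^+ R & b ^+ n = a ^+ e].
  apply/(B_rels_eval (pres_gen (B_rels Mz n Rz 1) : bool -> B)) => w.
  by apply: word_eval_rel.
pose nf (p : 'I_M * 'I_n) : B := a ^+ p.1 * b ^+ p.2.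
have nf_surj g : exists p, g = nf p.
  have [k [l ->]] : exists k l, g = a ^+ k * b ^+ l; last first.
    exact: (metacyclic_normal_form M_gt0 n_gt0 aM bn).
  elim/pres_group_ind: g => [|x g [k [l ->]]|x g [k [l ->]]].
  - by exists 0%N, 0%N; rewrite !expg0 mulg1.
  - have -> : pres_gen (B_rels Mz n Rz 1) x = a ^+ (~~ x) * b ^+ (x : bool).
      by case: x; rewrite /= expg1 expg0 ?mulg1 ?mul1g.
    exact: metacyclic_mul baV _ _ _ _.
  - have [i [j ->]] : exists i j,
        (pres_gen (B_rels Mz n Rz 1) x : B)^-1 = a ^+ i * b ^+ j.
      case: x; first by have [i] := metacyclic_invb M_gt0 n_gt0 aM bn; exists i, n.-1.
      by exists M.-1, 0%N; apply: metacyclic_inva.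
    exact: metacyclic_mul baV _ _ _ _.
pose f : B -> twist ok := pres_lift h.
have fM : {morph f : x y / x * y} by apply: pres_liftM.
have f_nf p : f (nf p) = alpha ^+ p.1 * beta ^+ p.2.
  by rewrite /f pres_liftM // !pres_liftX // !pres_lift_gen.
have fnf_inj : injective (f \o nf).
  by move=> p q /=; rewrite !f_nf; apply: tw_normal_form_inj.
have [k kK Kk] : bijective (f \o nf).
  apply: inj_card_bij => //.
  by rewrite card_twist card_prod !card_ord defN.
apply: (group_isogI fM); exists (nf \o k) => [g | t]; last exact: Kk.
by have [p ->] := nf_surj g; rewrite /= kK.
Qed.

End BGroup.

Local Close Scope group_scope.
Local Open Scope ring_scope.

(** * Arithmetic of r ^ n - s ^ n *)

Lemma eqmodz_nat (K : int) (a b : nat) :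
  (a = b %[mod `|K|])%N <-> (a%:Z = b%:Z %[mod K])%Z.
Proof.
rewrite -(modz_abs a) -(modz_abs b) !modz_nat.
by split=> [->|[]].
Qed.

Lemma eqmodzP (K a b : int) : (a = b %[mod K])%Z <-> (K %| a - b)%Z.
Proof. by split=> [/eqP|] ab; [|apply/eqP]; move: ab; rewrite eqz_mod_dvd. Qed.

Lemma eqmodzD (K a b a' b' : int) : (a = a' %[mod K])%Z -> (b = b' %[mod K])%Z ->
  (a + b = a' + b' %[mod K])%Z.
Proof. by move=> aa' bb'; rewrite -modzDm aa' bb' modzDm. Qed.

Lemma eqmodzM (K a b a' b' : int) : (a = a' %[mod K])%Z -> (b = b' %[mod K])%Z ->
  (a * b = a' * b' %[mod K])%Z.
Proof. by move=> aa' bb'; rewrite -modzMm aa' bb' modzMm. Qed.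

Lemma eqmodzX (K a a' : int) k : (a = a' %[mod K])%Z -> (a ^+ k = a' ^+ k %[mod K])%Z.
Proof. by move=> aa'; rewrite -modzXm aa' modzXm. Qed.

Lemma eqmodz_dvd (D K a b : int) :
  (D %| K)%Z -> (a = b %[mod K])%Z -> (a = b %[mod D])%Z.
Proof. by move=> DK /eqmodzP ab; apply/eqmodzP; apply: dvdz_trans ab. Qed.

Lemma eqmodz_sum (K : int) m (F G : nat -> int) :
  (forall i, (i < m)%N -> (F i = G i %[mod K])%Z) ->
  (\sum_(i < m) F i = \sum_(i < m) G i %[mod K])%Z.
Proof.
move=> FG; elim: m FG => [|m IHm] FG; first by rewrite !big_ord0.
rewrite !big_ord_recr /=; apply: eqmodzD; last exact: FG.
by apply: IHm => i im; apply/FG/ltnW.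
Qed.

(** The map i |-> A * i permutes the exponents modulo n. *)
Lemma geom_sum_coprime_exp N n x A : (0 < n)%N -> coprime A n ->
  (x ^ n = 1 %[mod N] -> geom_sum (x ^ A) n = geom_sum x n %[mod N])%N.
Proof.
move=> n_gt0 co_An xn1; rewrite /geom_sum.
pose h (i : 'I_n) := Ordinal (ltn_pmod (A * i) n_gt0).
have h_inj : injective h.
  move=> i j [/eqP]; wlog le_ij : i j / (i <= j)%N => [IH ij|].
    case: (leqP i j) => [|/ltnW] le; first exact: IH.
    by apply/esym/IH => //; rewrite eq_sym.
  rewrite eq_sym eqn_mod_dvd ?leq_mul2l ?le_ij ?orbT // -mulnBr.
  rewrite Gauss_dvdr 1?coprime_sym // -eqn_mod_dvd // => /eqP.
  by rewrite !modn_small // => /val_inj.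
rewrite [in RHS](reindex_inj h_inj) /= -modn_summ -[in RHS]modn_summ.
congr (_ %% N)%N; apply: eq_bigr => i _; rewrite -expnM.
by apply: (eqmodn_exp xn1); rewrite modn_mod.
Qed.


Lemma PoszX (a k : nat) : (a ^ k)%N%:Z = a%:Z ^+ k.
Proof. by rewrite -!natz natrX. Qed.

Lemma absz_diff_eq (a b : nat) :
  (a = b + `|a%:Z - b%:Z| \/ b = a + `|a%:Z - b%:Z|)%N.
Proof. lia. Qed.

Lemma Posz_rep (K z : int) : K != 0 -> exists c : nat, (z = c%:Z %[mod K])%Z.
Proof.
by move=> K0; exists `|(z %% K)%Z|%N; rewrite gez0_abs ?modz_ge0 // modz_mod.
Qed.

Lemma eqmodz_unit_coprime (K u : int) (c : nat) :
  (c%:Z * u = 1 %[mod K])%Z -> coprime c `|K|.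
Proof.
move=> /eqmodzP cu1; rewrite /coprime -dvdn1; set g := gcdn _ _.
have gc : (g %| c%:Z)%Z by rewrite dvdzE dvdn_gcdl.
have gK : (g %| K)%Z by rewrite dvdzE dvdn_gcdr.
suff: (g %| 1%R)%Z by []; rewrite -(subKr (c%:Z * u) 1).
by apply: rpredB; [exact: dvdz_mulr | exact: dvdz_trans gK cu1].
Qed.

Section PowerDifference.
Variables (n r s rhat A : nat).
Let K : int := r%:Z ^+ n - s%:Z ^+ n.
Let N : nat := `|K|%N.
Hypothesis ok : cyclic_ok n r s N rhat A.
Let x := (s * rhat)%N.
Let R := (x ^ A)%N.

Definition power_cofactor : int := \sum_(i < n) r%:Z ^+ (n.-1 - i) * s%:Z ^+ i.
Local Notation T := power_cofactor.

Lemma power_diff_factor : K = (r%:Z - s%:Z) * T.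
Proof. exact: subrXX. Qed.

(** Modulo n, each of the n terms of the cofactor is r ^ (n-1). *)
Lemma dvdz_cofactor : (n %| T)%Z.
Proof.
have [[_ _ rs] _ _ _] := ok.
have rsz : (s%:Z = r%:Z %[mod n])%Z by apply/esym/(eqmodz_nat n).
have : (T = \sum_(i < n) r%:Z ^+ n.-1 %[mod n])%Z.
  apply: (@eqmodz_sum _ _ (fun i => r%:Z ^+ (n.-1 - i) * s%:Z ^+ i)
    (fun=> r%:Z ^+ n.-1)) => i lt_in.
  have le_in : (i <= n.-1)%N by rewrite -ltnS (ltn_predK lt_in).
  have <- : r%:Z ^+ (n.-1 - i) * r%:Z ^+ i = r%:Z ^+ n.-1 by rewrite -exprD subnK.
  by apply: eqmodzM => //; apply: eqmodzX.
rewrite sumr_const card_ord -mulr_natl natz => /eqmodzP.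
by rewrite rpredBr // dvdz_mulr.
Qed.

(** Each of gcd (M, R - 1) and r - s divides the other: r - s divides M because n
    divides the cofactor T, and it divides R - 1 because s / r is 1 modulo
    r - s; conversely r * R ^ r = s modulo K gives r = s modulo the gcd. *)
Lemma gcd_root (M Rz : int) : K = M * n -> (Rz = R%:Z %[mod K])%Z ->
  gcdz M (Rz - 1) = `|r%:Z - s%:Z|.
Proof.
move=> defK RzR; have [[N_gt0 nN _] _ rr' _] := ok.
have n0 : n%:Z != 0 by rewrite eqz_nat -lt0n (dvdn_gt0 N_gt0).
have rs_M : (r%:Z - s%:Z %| M)%Z.
  have /dvdzP[q defT] := dvdz_cofactor; apply/dvdzP; exists q.
  by apply: (mulIf n0); rewrite -defK power_diff_factor defT mulrC mulrAC.
have M_K : (M %| K)%Z by rewrite defK dvdz_mulr.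
have R1 : (Rz = 1 %[mod r%:Z - s%:Z])%Z.
  rewrite (eqmodz_dvd (dvdz_trans rs_M M_K) RzR); apply/eqmodz_nat.
  apply: eqmodn1X; have rs_N : (`|r%:Z - s%:Z| %| N)%N by exact: dvdz_trans rs_M M_K.
  rewrite -(eqmodn_dvd rs_N rr'); apply: eqmodnM => //.
  by apply/eqmodz_nat/eqmodzP; rewrite -opprB rpredN.
set g := gcdz M (Rz - 1).
have gM : (g %| M)%Z := dvdz_gcdl _ _.
have g_rs : (g %| r%:Z - s%:Z)%Z.
  have gK := dvdz_trans gM M_K; apply/eqmodzP.
  have /eqmodz_nat := twist_root_r ok; rewrite PoszM PoszX => /(eqmodz_dvd gK) <-.
  rewrite -[in LHS](mulr1 r%:Z); apply: eqmodzM => //; rewrite -(expr1n _ r).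
  apply/eqmodzX; rewrite -(eqmodz_dvd gK RzR); apply/esym/eqmodzP.
  exact: dvdz_gcdr.
have rs_g : (r%:Z - s%:Z %| g)%Z.
  by rewrite dvdz_gcd rs_M; apply/eqmodzP.
have : (`|g| == `|r%:Z - s%:Z|)%N by rewrite eqn_dvd; apply/andP.
by rewrite -eqz_nat -abszE => /eqP <-.
Qed.

(** Up to the unit rhat ^ (n - 1), the sum of the powers of R is the cofactor
    of r - s in r ^ n - s ^ n: A only permutes the powers of s / r. *)
Lemma geom_sum_root :
  ((geom_sum R n)%:Z = rhat%:Z ^+ n.-1 * T %[mod K])%Z.
Proof.
have [[N_gt0 nN _] _ rr' rA] := ok.
have n_gt0 : (0 < n)%N by apply: dvdn_gt0 nN.
have co_An : coprime A n.
  by apply: (@eqmodz_unit_coprime n r); rewrite mulrC -PoszM; apply/(eqmodz_nat n).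
have /eqmodz_nat-> := geom_sum_coprime_exp n_gt0 co_An (ratio_exp_n ok).
rewrite /geom_sum -natz natr_sum /power_cofactor mulr_sumr.
under eq_bigr do rewrite natz PoszX.
apply: (@eqmodz_sum _ _ (fun i => x%:Z ^+ i)
  (fun i => rhat%:Z ^+ n.-1 * (r%:Z ^+ (n.-1 - i) * s%:Z ^+ i))) => i lt_in.
have le_in : (i <= n.-1)%N by rewrite -ltnS prednK.
have <- : rhat%:Z ^+ (n.-1 - i) * rhat%:Z ^+ i = rhat%:Z ^+ n.-1.
  by rewrite -exprD subnK.
rewrite mulrACA -!exprMn -[x%:Z ^+ i]mul1r.
apply: eqmodzM; last by rewrite /x PoszM mulrC.
rewrite -(expr1n _ (n.-1 - i)); apply/esym/eqmodzX; rewrite mulrC -PoszM.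
exact/eqmodz_nat.
Qed.

End PowerDifference.

Theorem corollary11 (n r s : nat) (n_gt0 : (0 < n)%N) (r_gt0 : (0 < r)%N)
    (s_gt0 : (0 < s)%N) (co_nr : coprime n r) (co_rs : coprime r s)
    (neq_rs : r <> s) (eq_rs_n : r = s %[mod n])
    (Abar rhat R : int)
    (AbarP : (r%:Z * Abar = 1 %[mod n%:Z])%Z)
    (rhatP : (r%:Z * rhat = 1 %[mod r%:Z ^+ n - s%:Z ^+ n])%Z)
    (RP : is_expz_mod (r%:Z ^+ n - s%:Z ^+ n) (s%:Z * rhat) Abar R) :
  let M : int := ((r%:Z ^+ n - s%:Z ^+ n) %/ n%:Z)%Z in
  [/\ (R ^+ n = 1 %[mod M])%Z,
      group_isog (H_group r n s n_gt0) (B_group M n%:Z R 1)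
    & exists gT : finGroupType,
        [/\ group_isog (H_group r n s n_gt0) gT,
            metacyclic [set: gT]
          & #|gT|%:Z = `|r%:Z ^+ n - s%:Z ^+ n|]].
Proof.
set K := r%:Z ^+ n - s%:Z ^+ n in rhatP RP *.
move=> M; pose N := `|K|%N.
have K0 : K != 0.
  rewrite subr_eq0 -!PoszX eqz_nat eqn_exp2r //; exact/eqP.
have n0 : n%:Z != 0 by rewrite eqz_nat -lt0n.
have nK : (n %| K)%Z.
  by apply/eqmodzP/eqmodzX/(eqmodz_nat n).
have [rh rhE] := Posz_rep rhat K0; have [A AE] := Posz_rep Abar n0.
have ok : cyclic_ok n r s N rh A.
  split; first by split; rewrite // absz_gt0.
  - by rewrite /N /K -!PoszX; apply: absz_diff_eq.
  - by apply/eqmodz_nat; rewrite -rhatP PoszM; apply: eqmodzM.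
  - by apply/(eqmodz_nat n); rewrite -AbarP PoszM; apply: eqmodzM.
pose x := (s * rh)%N; pose R0 := (x ^ A)%N.
have xE : (s%:Z * rhat = x%:Z %[mod K])%Z by rewrite PoszM; apply: eqmodzM.
have xn1 := ratio_exp_n ok.
have RE : (R = R0%:Z %[mod K])%Z.
  (* For a negative exponent - m.+1, the product of x ^ m.+1 and x ^ A is 1. *)
  case: Abar RP AE {AbarP} => m /=.
    move=> -> /(eqmodz_nat n) mA; rewrite (eqmodzX m xE) -PoszX.
    by apply/eqmodz_nat/(eqmodn_exp xn1).
  rewrite NegzE => Rm mA.
  have xAm : (x%:Z ^+ m.+1 * x%:Z ^+ A = 1 %[mod K])%Z.
    rewrite -exprD -PoszX; apply/eqmodz_nat; rewrite -(expn0 x).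
    apply: (eqmodn_exp xn1); apply/(eqmodz_nat n)/eqmodzP.
    by move/esym/eqmodzP: mA; rewrite opprK subr0 PoszD addrC.
  rewrite -[in LHS](mulr1 R) -(eqmodzM (erefl (R %% K)%Z) xAm) mulrA PoszX.
  rewrite -[in RHS](mul1r (x%:Z ^+ A)); apply: eqmodzM => //; rewrite -Rm.
  by apply: eqmodzM => //; apply/esym/eqmodzX.
have defK : K = M * n by rewrite /M divzK.
have MK : (M %| K)%Z by rewrite defK dvdz_mulr.
pose tok := twist_root_ok ok.
have [_ _ _ R0n] := tok.
have gM := gcd_root ok defK RE.
have D0 : r%:Z - s%:Z != 0 by rewrite subr_eq0 eqz_nat; apply/eqP.
have /dvdzP[q defT] := dvdz_cofactor ok.
(* The value M / gcd (M, R - 1) is sg * q, where n * q is the cofactor of r - s. *)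
pose sg := sgz (r%:Z - s%:Z).
have sg2 : sg * sg = 1 by rewrite /sg mulz_sg D0.
have defM : M = sg * q * `|r%:Z - s%:Z|.
  apply: (mulIf n0); rewrite -defK [K](power_diff_factor n r s) defT.
  by rewrite {1}(intEsg (r%:Z - s%:Z)) -/sg abszE; ring.
have eE : (1 * M %/ gcdz M (R - 1))%Z = sg * q.
  by rewrite mul1r gM {1}defM mulzK // normr_eq0.
have M0 : M != 0 by apply: contraNneq K0 => M0; rewrite defK M0 mul0r.
have [e eP] := Posz_rep (sg * q) M0.
have [c cP] := Posz_rep (sg * rh%:Z ^+ n.-1) K0.
have co_cN : coprime c N.
  apply: (@eqmodz_unit_coprime K (sg * r%:Z ^+ n.-1)).
  have [_ _ rr' _] := ok.
  rewrite -(eqmodzM cP (erefl _)) mulrACA sg2 mul1r -exprMn -(expr1n _ n.-1).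
  by apply/eqmodzX; rewrite mulrC -PoszM; apply/eqmodz_nat.
have ce : (n * c * e = geom_sum R0 n %[mod N])%N.
  apply/eqmodz_nat; rewrite (geom_sum_root ok) defT !PoszM.
  have -> : rh%:Z ^+ n.-1 * (q * n) = sg * rh%:Z ^+ n.-1 * (n%:Z * (sg * q)).
    by rewrite -[q in LHS]mul1r -sg2; ring.
  rewrite mulrAC mulrC; apply: eqmodzM; first by rewrite cP.
  by apply/eqmodzP; rewrite defK -mulrBr [M * _]mulrC dvdz_mul2l //; apply/eqmodzP/esym.
have isoH := H_group_twist n_gt0 ok.
split.
- apply: eqmodz_dvd MK _; rewrite (eqmodzX n RE) -PoszX; exact/eqmodz_nat.
- apply: group_isog_trans isoH _; apply: group_isog_sym.
  apply: (B_group_twist (twist_root_ok ok) (M := `|M|%N) _ co_cN ce) => //.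
  + by rewrite /N defK abszM.
  + by rewrite !modz_abs; apply: eqmodz_dvd RE.
  + by rewrite !modz_abs eE.
- exists (twist tok); split => //; first exact: twist_metacyclic.
  by rewrite card_twist abszE.
Qed.
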